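(* Let $A\in\mathbb{R}^{n\times n}$, $B\in\mathbb{R}^{n\times m}$, $Q\in\mathbb{R}^{n\times n}$, $S\in\mathbb{R}^{n\times m}$, $R\in\mathbb{R}^{m\times m}$ be such that $\Pi=\begin{bmatrix} Q & S \\ S^\top & R \end{bmatrix}=\Pi^\top\ge 0$, and let $\Sigma=(A,B;\Pi)$. Let $A_0=A-BR^\dagger S^\top$, $Q_0=Q-SR^\dagger S^\top$, $\nu=\dim(\ker A_0)$, and let $U=[\,U_1\;\;U_2\,]\in\mathbb{R}^{n\times n}$ be an orthogonal matrix with $\operatorname{im}U_2=\ker A_0$. Write $U^\top A_0U=[\,\tilde A\;\;0_{n\times\nu}\,]$ with $\tilde A=\begin{bmatrix} A_1 \\ A_{21} \end{bmatrix}$, $A_1\in\mathbb{R}^{(n-\nu)\times(n-\nu)}$; $B_U=U^\top B=\begin{bmatrix} B_1 \\ B_2 \end{bmatrix}$, $B_1\in\mathbb{R}^{(n-\nu)\times m}$; $Q_U=U^\top Q_0U$; and $Q_1=\tilde A^\top Q_U\tilde A$, $S_1=\tilde A^\top Q_UB_U$, $R_1=R+B_U^\top Q_UB_U$. Then the set of solutions of CGDARE($\Sigma$) is exactly the set of matrices of the form $$X=U\begin{bmatrix} \Delta_1 & 0 \\ 0 & 0 \end{bmatrix}U^\top+Q_0,$$ where $\Delta_1\in\mathbb{R}^{(n-\nu)\times(n-\nu)}$ ranges over the symmetric solutions of $$\Delta_1=A_1^\top\Delta_1A_1-(A_1^\top\Delta_1B_1+S_1)(R_1+B_1^\top\Delta_1B_1)^\dagger(B_1^\top\Delta_1A_1+S_1^\top)+Q_1,$$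 $$\ker(R_1+B_1^\top\Delta_1B_1)\subseteq\ker(S_1+A_1^\top\Delta_1B_1).$$
   Context: $M^\dagger$ denotes the Moore-Penrose pseudo-inverse of a real matrix $M$. For $\Sigma=(A,B;\Pi)$ with $\Pi=\begin{bmatrix} Q & S \\ S^\top & R \end{bmatrix}=\Pi^\top\ge0$ (positive semidefinite), CGDARE($\Sigma$) (the constrained generalized discrete-time algebraic Riccati equation) is the pair of relations in the unknown $X$ $$X=A^\top XA-(A^\top XB+S)(R+B^\top XB)^\dagger(S^\top+B^\top XA)+Q,$$ $$\ker(R+B^\top XB)\subseteq\ker(A^\top XB+S).$$ Only real symmetric solutions are considered: ''solution'' always means real symmetric solution. *)

(* Defs.v *)
From mathcomp Require Export all_boot all_order all_algebra.
From mathcomp Require Export reals.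

Set Implicit Arguments.
Unset Strict Implicit.
Unset Printing Implicit Defensive.

Export Order.TTheory GRing.Theory Num.Theory.
Open Scope ring_scope.

(* Matrices act on column vectors, so kernels and images are subspaces of     *)
(* 'cV_n, unlike the row spaces handled by kermx and the %MS operations.      *)
Definition ker (K : fieldType) (p q : nat) (M : 'M[K]_(p, q)) :
  {vspace 'cV[K]_q} := lker (linfun (mulmx M : 'cV[K]_q -> 'cV[K]_p)).

Definition im (K : fieldType) (p q : nat) (M : 'M[K]_(p, q)) :
  {vspace 'cV[K]_p} := limg (linfun (mulmx M : 'cV[K]_q -> 'cV[K]_p)).

Lemma memv_kerE (K : fieldType) (p q : nat) (M : 'M[K]_(p, q)) (v : 'cV[K]_q) :
  (v \in ker M) = (M *m v == 0).
Proof. by rewrite memv_ker lfunE. Qed.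

Lemma memv_imP (K : fieldType) (p q : nat) (M : 'M[K]_(p, q)) (w : 'cV[K]_p) :
  reflect (exists v : 'cV[K]_q, w = M *m v) (w \in im M).
Proof.
apply: (iffP memv_imgP) => [[v _ ->]|[v ->]]; exists v => //.
- by rewrite lfunE.
- exact: memvf.
- by rewrite lfunE.
Qed.

(* U is allowed a rectangular type because the column count of a block matrix *)
(* [U1 U2] is only provably, not definitionally, equal to its row count.      *)
Definition orthogonal_mx (K : fieldType) (p q : nat) (U : 'M[K]_(p, q)) : Prop :=
  U^T *m U = 1%:M /\ U *m U^T = 1%:M.

Definition possemidef (K : numFieldType) (n : nat) (M : 'M[K]_n) : Prop :=
  forall v : 'cV[K]_n, 0 <= (v^T *m M *m v) 0 0.

Definition penrose (K : fieldType) (p q : nat)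
    (M : 'M[K]_(p, q)) (N : 'M[K]_(q, p)) : Prop :=
  [/\ M *m N *m M = M, N *m M *m N = N,
      (M *m N)^T = M *m N & (N *m M)^T = N *m M].

(* The Moore-Penrose pseudo-inverse, computed from a full-rank factorization  *)
(* M = C F as F^T (F F^T)^-1 (C^T C)^-1 C^T; see mpinvP below.                *)
Definition mpinv (K : fieldType) (p q : nat) (M : 'M[K]_(p, q)) :
    'M[K]_(q, p) :=
  let C := col_base M in let F := row_base M in
  F^T *m invmx (F *m F^T) *m invmx (C^T *m C) *m C^T.

Lemma penrose_uniq (K : fieldType) (p q : nat)
    (M : 'M[K]_(p, q)) (N N' : 'M[K]_(q, p)) :
  penrose M N -> penrose M N' -> N = N'.
Proof.
move=> [a b c d] [a' b' c' d'].
have e1 : M *m N = M *m N'.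
  rewrite -{1}a' -mulmxA -c -c' -trmx_mul !mulmxA a c'.
  by [].
have e2 : N *m M = N' *m M.
  rewrite -{1}a' 2!mulmxA -(mulmxA (N *m M)) -d -d' -trmx_mul.
  by rewrite -(mulmxA N') (mulmxA M) a.
by rewrite -b e2 -mulmxA e1 mulmxA b'.
Qed.

Lemma gram_unit (K : realFieldType) (p q : nat) (F : 'M[K]_(p, q)) :
  row_free F -> F *m F^T \in unitmx.
Proof.
move=> freeF; rewrite -row_free_unit -kermx_eq0.
apply/rowV0P => u /sub_kermxP uG0.
have uF0 : u *m F = 0.
  have : (u *m F) *m (u *m F)^T = 0.
    by rewrite trmx_mul !mulmxA -(mulmxA u F) uG0 mul0mx.
  move=> /matrixP /(_ 0 0); rewrite !mxE => /eqP.
  rewrite psumr_eq0; last by move=> j _; rewrite [_^T _ _]mxE -expr2 sqr_ge0.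
  move=> /allP s0; apply/rowP => j; apply/eqP; rewrite [X in _ == X]mxE.
  have := s0 j (mem_index_enum _).
  by rewrite [_^T _ _]mxE -expr2 sqrf_eq0.
by apply: (row_free_inj freeF); rewrite mul0mx.
Qed.

Lemma mpinv_penrose (K : realFieldType) (p q : nat) (M : 'M[K]_(p, q)) :
  penrose M (mpinv M).
Proof.
rewrite /penrose /mpinv.
set C := col_base M; set F := row_base M.
have MCF : M = C *m F by rewrite mulmx_base.
have uF : F *m F^T \in unitmx by exact/gram_unit/row_base_free.
have uC : C^T *m C \in unitmx.
  rewrite -{2}[C]trmxK; apply: gram_unit.
  by rewrite /row_free mxrank_tr; exact: col_base_full.
clearbody C F; move: (\rank M) C F MCF uF uC => r C F -> uF uC.
set G := F *m F^T in uF *; set H := C^T *m C in uC *.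
have symG : (invmx G)^T = invmx G by rewrite trmx_inv trmx_mul trmxK.
have symH : (invmx H)^T = invmx H by rewrite trmx_inv trmx_mul trmxK.
have MN : C *m F *m (F^T *m invmx G *m invmx H *m C^T) = C *m invmx H *m C^T.
  by rewrite !mulmxA -(mulmxA C F F^T) -/G mulmxK.
have NM : F^T *m invmx G *m invmx H *m C^T *m (C *m F) = F^T *m invmx G *m F.
  by rewrite !mulmxA -(mulmxA _ C^T C) -/H mulmxKV.
split.
- by rewrite MN !mulmxA -(mulmxA _ C^T C) -/H mulmxKV.
- by rewrite NM !mulmxA -(mulmxA _ F F^T) -/G mulmxKV.
- by rewrite MN !trmx_mul trmxK symH mulmxA.
- by rewrite NM !trmx_mul trmxK symG mulmxA.
Qed.

Lemma mpinvP (K : realFieldType) (p q : nat)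
    (M : 'M[K]_(p, q)) (N : 'M[K]_(q, p)) :
  penrose M N <-> N = mpinv M.
Proof.
split=> [h|->]; last exact: mpinv_penrose.
exact: penrose_uniq h (mpinv_penrose M).
Qed.

(* The constrained generalized discrete-time algebraic Riccati equation; only *)
(* symmetric X count as solutions.                                            *)
Definition cgdare_solution (K : fieldType) (n m : nat)
    (A : 'M[K]_n) (B : 'M[K]_(n, m))
    (Q : 'M[K]_n) (S : 'M[K]_(n, m)) (R : 'M[K]_m) (X : 'M[K]_n) : Prop :=
  [/\ X^T = X,
      X = A^T *m X *m A
          - (A^T *m X *m B + S) *m mpinv (R + B^T *m X *m B)
            *m (S^T + B^T *m X *m A)
          + Q
    & (ker (R + B^T *m X *m B) <= ker (A^T *m X *m B + S))%VS].

(* Main.v *)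
Require Import Defs.
From mathcomp Require Import ring.

(** The feedback [F = R^+ S^T] removes the cross term [S] and turns [(A, Q)]
    into [(A0, Q0)]; this is exact because positivity of the Popov matrix gives
    [S R^+ R = S]. With no cross term the Riccati equation reads
    [X - Q0 = A0^T (...) A0], so [X - Q0] vanishes on [ker A0]; in coordinates
    adapted to [ker A0] it is therefore a single block [Delta1], and substituting
    [X = Delta1 + Q0] gives the reduced equation. *)

(* Products are generalized first so that [mxE] does not expand them into sums. *)
Ltac mx_linear :=
  rewrite ?(mulmxBl, mulmxBr, mulmxDl, mulmxDr, mulmxA, mulNmx, mulmxN);
  repeat match goal with |- context [?a *m ?b] => move: (a *m b) => ? end;
  let i := fresh in let j := fresh in
  apply/matrixP => i j; rewrite !mxE; ring.

(** * Kernel inclusions, the pseudo-inverse and positivity *)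

Section Kernels.
Set Implicit Arguments.
Unset Strict Implicit.
Variable K : realFieldType.

Lemma ker_subP (p q r : nat) (M : 'M[K]_(p, q)) (N : 'M[K]_(r, q)) :
  reflect (forall v : 'cV[K]_q, M *m v = 0 -> N *m v = 0) (ker M <= ker N)%VS.
Proof.
apply: (iffP subvP) => h v.
- by move/eqP; rewrite -memv_kerE => /h; rewrite memv_kerE => /eqP.
- by rewrite !memv_kerE => /eqP /h ->.
Qed.

(** The columns of [1%:M - mpinv M *m M] lie in the kernel of [M], so [N] kills them under the
    inclusion. Kernel constraints thus become equations usable for rewriting. *)
Lemma ker_sub_mpinvP (p q r : nat) (M : 'M[K]_(p, q)) (N : 'M[K]_(r, q)) :
  reflect (N *m mpinv M *m M = N) (ker M <= ker N)%VS.
Proof.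
have [MNM _ _ _] := mpinv_penrose M.
apply: (iffP (ker_subP M N)) => [h|<- v Mv0]; last by rewrite -mulmxA Mv0 mulmx0.
suff /eqP: N *m (1%:M - mpinv M *m M) = 0.
  by rewrite mulmxBr mulmx1 subr_eq0 mulmxA => /eqP.
apply/matrixP => i j; rewrite [RHS]mxE.
have /h : M *m col j (1%:M - mpinv M *m M) = 0.
  by rewrite colE mulmxA mulmxBr mulmx1 mulmxA MNM subrr mul0mx.
by rewrite colE mulmxA -colE => /matrixP /(_ i 0); rewrite mxE => ->; rewrite mxE.
Qed.

Lemma mpinv_tr (p q : nat) (M : 'M[K]_(p, q)) : mpinv M^T = (mpinv M)^T.
Proof.
symmetry; apply/mpinvP; move: (mpinv M) (mpinv_penrose M) => N [a b c d].
by split; rewrite -!trmx_mul ?mulmxA ?a ?b ?c ?d ?c ?d.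
Qed.

(** If [R v = 0], the quadratic form at [(S v, t v)] is affine in [t] with slope [2 |S v|^2];
    nonnegativity for every [t] forces the slope to vanish. *)
Lemma possemidef_block_ker (n m : nat) (Q : 'M[K]_n) (S : 'M[K]_(n, m))
    (R : 'M[K]_m) :
  possemidef (block_mx Q S S^T R) -> (ker R <= ker S)%VS.
Proof.
move=> pos; apply/ker_subP => v Rv0; set w := S *m v.
pose s := (w^T *m w) 0 0; pose q := (w^T *m Q *m w) 0 0.
have ineq t : 0 <= q + 2 * t * s.
  have := pos (col_mx w (t *: v)).
  rewrite tr_col_mx -mulmxA mul_block_col mul_row_col.
  rewrite -!scalemxAr Rv0 -/w scaler0 addr0 linearZ /= mulmxDr -scalemxAr.
  rewrite -scalemxAl [v^T *m _]mulmxA -trmx_mul -/w mulmxA.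
  by rewrite ![fun_of_matrix (_ + _) _ _]mxE ![fun_of_matrix (_ *: _) _ _]mxE
             -/s -/q; congr (0 <= _); ring.
have s0 : s = 0.
  apply/eqP; apply: contraT => sN0.
  (* This [t] is where the affine function takes the value [-1]. *)
  have := ineq (- (q + 1) / (2 * s)).
  have -> : q + 2 * (- (q + 1) / (2 * s)) * s = - 1 by field.
  by rewrite oppr_ge0 ler10.
apply/colP => i; rewrite [RHS]mxE; apply/eqP; rewrite -sqrf_eq0.
move/eqP: s0; rewrite /s mxE psumr_eq0.
  by move=> /allP /(_ i (mem_index_enum _)); rewrite mxE -expr2.
by move=> j _; rewrite mxE -expr2 sqr_ge0.
Qed.

End Kernels.

(** * Feedback and change of basis in the Riccati equation *)

Section Riccati.
Set Implicit Arguments.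
Unset Strict Implicit.
Variable K : realFieldType.

(** Symmetry of [X] makes the third factor the transpose of [SX], so the pseudo-inverse term and the
    constraint depend on [RX] and [SX] alone. *)
Lemma cgdare_solutionP (n m : nat) (A Q : 'M[K]_n) (B S : 'M[K]_(n, m))
    (R : 'M[K]_m) (X : 'M[K]_n) :
  let RX := R + B^T *m X *m B in
  let SX := A^T *m X *m B + S in
  cgdare_solution A B Q S R X <->
  [/\ X^T = X, X = A^T *m X *m A - SX *m mpinv RX *m SX^T + Q
    & SX *m mpinv RX *m RX = SX].
Proof.
move=> RX SX.
have tS : X^T = X -> SX^T = S^T + B^T *m X *m A.
  by move=> sX; rewrite /SX linearD /= !trmx_mul trmxK sX mulmxA addrC.
split=> -[sX e k]; split=> //.
- by rewrite (tS sX).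
- exact/ker_sub_mpinvP.
- by rewrite -/RX -/SX -(tS sX).
- exact/ker_sub_mpinvP.
Qed.

(** Feedback fixes [RX] and replaces [SX] by [SX - F^T RX]. The constraint cancels [mpinv RX]
    against [RX], so the quadratic term changes only by terms free of the pseudo-inverse. *)
Lemma cgdare_feedback_imp (n m : nat) (A Q : 'M[K]_n) (B S : 'M[K]_(n, m))
    (R : 'M[K]_m) (F : 'M[K]_(m, n)) (X : 'M[K]_n) : R^T = R ->
  cgdare_solution A B Q S R X ->
  cgdare_solution (A - B *m F) B (Q - S *m F - F^T *m S^T + F^T *m R *m F)
    (S - F^T *m R) R X.
Proof.
move=> sR /cgdare_solutionP; set RX := R + _; set SX := _ + S.
move=> [sX eX kX]; apply/cgdare_solutionP; rewrite -/RX.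
have sRX : RX^T = RX by rewrite /RX linearD /= !trmx_mul trmxK sX sR mulmxA.
have sP : (mpinv RX)^T = mpinv RX by rewrite -mpinv_tr sRX.
have -> : (A - B *m F)^T *m X *m B + (S - F^T *m R) = SX - F^T *m RX.
  rewrite /SX /RX linearB /= trmx_mul.
  mx_linear.
have -> : (SX - F^T *m RX)^T = SX^T - RX *m F.
  by rewrite linearB /= trmx_mul trmxK sRX.
move: (mpinv RX) (mpinv_penrose RX) sP eX kX => P [RPR _ _ _] sP eX kX.
(* The transposed constraint gives the same cancellation from the left. *)
have kX' : RX *m P *m SX^T = SX^T by rewrite -{2}kX !trmx_mul sRX sP mulmxA.
split=> //; last by rewrite !mulmxBl kX -!(mulmxA F^T) RPR.
have -> : (SX - F^T *m RX) *m P *m (SX^T - RX *m F)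
    = SX *m P *m SX^T - SX *m F - F^T *m SX^T + F^T *m (RX *m F).
  rewrite mulmxBr !mulmxBl !mulmxA kX -!(mulmxA F^T) kX' RPR.
  mx_linear.
(* Expanding only the left-hand [X] puts the same term [W] on both sides; the rest is a polynomial
   identity. *)
rewrite {1}eX; move: (SX *m P *m SX^T) => W.
have -> : SX^T = B^T *m X *m A + S^T.
  by rewrite /SX linearD /= !trmx_mul trmxK sX mulmxA.
have -> : (A - B *m F)^T = A^T - F^T *m B^T by rewrite linearB /= trmx_mul.
rewrite /SX /RX.
mx_linear.
Qed.

Lemma cgdare_feedback (n m : nat) (A Q : 'M[K]_n) (B S : 'M[K]_(n, m))
    (R : 'M[K]_m) (F : 'M[K]_(m, n)) (X : 'M[K]_n) : R^T = R ->
  cgdare_solution A B Q S R X <->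
  cgdare_solution (A - B *m F) B (Q - S *m F - F^T *m S^T + F^T *m R *m F)
    (S - F^T *m R) R X.
Proof.
move=> sR; split; first exact: cgdare_feedback_imp.
(* The feedback [- F] undoes [F]. *)
move=> /(cgdare_feedback_imp (- F) sR).
have -> : A - B *m F - B *m - F = A by rewrite mulmxN opprK subrK.
have -> : S - F^T *m R - (- F)^T *m R = S by rewrite linearN /= mulNmx opprK subrK.
set Q' := (X in cgdare_solution _ _ X); suff -> : Q' = Q by [].
rewrite /Q' !(linearB, linearN) /= trmx_mul trmxK sR.
mx_linear.
Qed.

(** [RX] is unchanged and [SX] becomes [V^T SX], so the pseudo-inverse itself is never transformed.
    [V] is rectangular to accommodate a block matrix with [(n - nu) + nu] columns. *)
Lemma cgdare_change_basis_imp (n p m : nat) (A Q : 'M[K]_n)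
    (B S : 'M[K]_(n, m)) (R : 'M[K]_m) (X : 'M[K]_n) (V : 'M[K]_(n, p)) :
  V *m V^T = 1%:M ->
  cgdare_solution A B Q S R X ->
  cgdare_solution (V^T *m A *m V) (V^T *m B) (V^T *m Q *m V) (V^T *m S) R
    (V^T *m X *m V).
Proof.
move=> VV /cgdare_solutionP; set RX := R + _; set SX := _ + S.
move=> [sX eX kX]; apply/cgdare_solutionP.
have VK k (Y : 'M[K]_(k, n)) : Y *m V *m V^T = Y by rewrite -mulmxA VV mulmx1.
have -> : R + (V^T *m B)^T *m (V^T *m X *m V) *m (V^T *m B) = RX.
  by rewrite trmx_mul trmxK !mulmxA !VK.
have -> : (V^T *m A *m V)^T *m (V^T *m X *m V) *m (V^T *m B) + V^T *m S
    = V^T *m SX.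
  by rewrite !trmx_mul trmxK !mulmxA !VK mulmxDr !mulmxA.
clearbody RX SX; move: (mpinv RX) eX kX => P eX kX.
split; first by rewrite !trmx_mul trmxK sX mulmxA.
- rewrite {1}eX !trmx_mul trmxK.
  by rewrite !(mulmxDr, mulmxDl, mulmxN, mulNmx, mulmxA) !VK.
- by rewrite -!mulmxA (mulmxA SX) kX.
Qed.

Lemma cgdare_change_basis (n p m : nat) (A Q : 'M[K]_n)
    (B S : 'M[K]_(n, m)) (R : 'M[K]_m) (X : 'M[K]_n) (V : 'M[K]_(n, p)) :
  orthogonal_mx V ->
  cgdare_solution A B Q S R X <->
  cgdare_solution (V^T *m A *m V) (V^T *m B) (V^T *m Q *m V) (V^T *m S) R
    (V^T *m X *m V).
Proof.
move=> [VtV VVt]; split; first exact: cgdare_change_basis_imp.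
have VK k (Y : 'M[K]_(n, k)) : V *m (V^T *m Y) = Y by rewrite mulmxA VVt mul1mx.
(* The converse is the same implication for [V^T]. *)
move/(@cgdare_change_basis_imp _ _ _ _ _ _ _ _ _ V^T); rewrite trmxK.
by move/(_ VtV); rewrite -!mulmxA !VK VVt !mulmx1.
Qed.

(** * Reduction to the leading block *)

Lemma tr_row_mx0_mul (p q r s : nat) (Y : 'M[K]_(r, p)) (X : 'M[K]_r)
    (Z : 'M[K]_(r, s)) :
  (row_mx Y (0 : 'M_(r, q)))^T *m X *m Z = col_mx (Y^T *m X *m Z) 0.
Proof. by rewrite tr_row_mx trmx0 !mul_col_mx !mul0mx. Qed.

Lemma row_mx0_congr (p q r : nat) (Y : 'M[K]_(r, p)) (X : 'M[K]_r) :
  (row_mx Y (0 : 'M_(r, q)))^T *m X *m row_mx Y (0 : 'M_(r, q))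
  = block_mx (Y^T *m X *m Y) 0 0 0.
Proof. by rewrite tr_row_mx0_mul mul_mx_row mulmx0 /block_mx row_mx0. Qed.

Lemma col_mx0_congr (p q m : nat) (Y : 'M[K]_(p, m)) (P : 'M[K]_m) :
  col_mx Y (0 : 'M_(q, m)) *m P *m (col_mx Y (0 : 'M_(q, m)))^T
  = block_mx (Y *m P *m Y^T) 0 0 0.
Proof.
rewrite tr_col_mx trmx0 !mul_col_mx !mul0mx mul_mx_row mulmx0.
by rewrite /block_mx row_mx0.
Qed.

Lemma block_mx0_sub (p q : nat) (E E' : 'M[K]_p) :
  block_mx E 0 0 (0 : 'M_q) - block_mx E' 0 0 0 = block_mx (E - E') 0 0 0.
Proof. by rewrite opp_block_mx add_block_mx !oppr0 !addr0. Qed.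

(** Apart from [Q], every term of the right-hand side is multiplied by [[At 0]^T] on the left and
    [[At 0]] on the right, so only its leading block survives. *)
Lemma cgdare_row_mx0 (p q m : nat) (At : 'M[K]_(p + q, p))
    (B : 'M[K]_(p + q, m)) (Q : 'M[K]_(p + q)) (R : 'M[K]_m)
    (X : 'M[K]_(p + q)) :
  cgdare_solution (row_mx At 0) B Q 0 R X ->
  exists D : 'M[K]_p, X = block_mx D 0 0 0 + Q.
Proof.
move=> /cgdare_solutionP [_ + _].
rewrite addr0 row_mx0_congr tr_row_mx0_mul col_mx0_congr block_mx0_sub => eX.
by eexists; exact: eX.
Qed.

Lemma cgdare_block_zero (p q m : nat) (At : 'M[K]_(p + q, p))
    (B : 'M[K]_(p + q, m)) (Q : 'M[K]_(p + q)) (R : 'M[K]_m) (D : 'M[K]_p) :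
  Q^T = Q ->
  cgdare_solution (row_mx At 0) B Q 0 R (block_mx D 0 0 0 + Q) <->
  cgdare_solution (usubmx At) (usubmx B) (At^T *m Q *m At) (At^T *m Q *m B)
    (R + B^T *m Q *m B) D.
Proof.
move=> sQ; set X := block_mx D 0 0 0 + Q.
(* The [D] summand of [X] sees only upper blocks; the [Q] summand produces the reduced weights. *)
have DE k l (Y : 'M[K]_(p + q, k)) (Z : 'M[K]_(p + q, l)) :
    Y^T *m X *m Z = (usubmx Y)^T *m D *m usubmx Z + Y^T *m Q *m Z.
  rewrite /X mulmxDr mulmxDl; congr (_ + _).
  rewrite -{1}(vsubmxK Y) -{1}(vsubmxK Z) tr_col_mx mul_row_block mul_row_col.
  by rewrite !mulmx0 !addr0 mul0mx addr0.
have eqR : R + B^T *m X *m B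
    = R + B^T *m Q *m B + (usubmx B)^T *m D *m usubmx B.
  by rewrite DE addrA addrAC.
have blockE (E E' : 'M[K]_p) :
    block_mx E 0 0 (0 : 'M_q) + Q = block_mx E' 0 0 0 + Q <-> E = E'.
  by split=> [/addIr /eq_block_mx [] | ->].
have tX : X^T = X <-> D^T = D.
  by rewrite /X linearD /= sQ tr_block_mx !trmx0 blockE.
have eqS' : (usubmx At)^T *m D *m usubmx B + At^T *m Q *m B = At^T *m X *m B.
  by rewrite DE.
have eqA' M : (usubmx At)^T *m D *m usubmx At - M + At^T *m Q *m At
    = At^T *m X *m At - M.
  by rewrite DE addrAC.
apply: (iff_trans (cgdare_solutionP _ _ _ _ _ _)); apply: iff_sym.
apply: (iff_trans (cgdare_solutionP _ _ _ _ _ _)); apply: iff_sym => /=.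
rewrite eqR addr0 row_mx0_congr tr_row_mx0_mul col_mx0_congr block_mx0_sub eqS' eqA'
  !mul_col_mx !mul0mx.
split=> -[sX eX kX]; split; first [exact/tX | exact/blockE | idtac].
(* The lower block of the constraint reads [0 = 0], so the upper one carries all of it. *)
- by case/eq_col_mx: kX.
- by rewrite kX.
Qed.

End Riccati.

Theorem corollary1 (K : realType) (n m nu : nat)
    (A : 'M[K]_n) (B : 'M[K]_(n, m))
    (Q : 'M[K]_n) (S : 'M[K]_(n, m)) (R : 'M[K]_m)
    (U1 : 'M[K]_(n, (n - nu)%N)) (U2 : 'M[K]_(n, nu)) :
  let Pi := block_mx Q S S^T R in
  let A0 := A - B *m mpinv R *m S^T in
  let Q0 := Q - S *m mpinv R *m S^T in
  let U := row_mx U1 U2 in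
  let AU := U^T *m A0 *m U in
  let Atil := lsubmx AU in
  let A1 := usubmx Atil in
  let BU := U^T *m B in
  let B1 := usubmx BU in
  let QU := U^T *m Q0 *m U in
  let Q1 := Atil^T *m QU *m Atil in
  let S1 := Atil^T *m QU *m BU in
  let R1 := R + BU^T *m QU *m BU in
  Pi = Pi^T ->
  possemidef Pi ->
  nu = \dim (ker A0) ->
  orthogonal_mx U ->
  im U2 = ker A0 ->
  AU = row_mx Atil 0 /\
  forall X : 'M[K]_n,
    cgdare_solution A B Q S R X <->
    exists Delta1 : 'M[K]_((n - nu)%N),
      cgdare_solution A1 B1 Q1 S1 R1 Delta1 /\
      X = U *m block_mx Delta1 0 0 0 *m U^T + Q0.
Proof.
move=> Pi A0 Q0 U AU Atil A1 BU B1 QU Q1 S1 R1 symPi posPi _ orthU imU2.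
have [sQ sR] : Q^T = Q /\ R^T = R.
  by move: symPi; rewrite /Pi tr_block_mx => /eq_block_mx [eQ _ _ eR]; split.
have SRR : S *m mpinv R *m R = S.
  exact/ker_sub_mpinvP/(possemidef_block_ker posPi).
(* Each column of [U2] lies in its image, which is the kernel of [A0]. *)
have A0U2 : A0 *m U2 = 0.
  apply/matrixP => i j; rewrite [RHS]mxE.
  have : col j U2 \in ker A0.
    by rewrite -imU2; apply/memv_imP; exists (delta_mx j 0); rewrite colE.
  by rewrite memv_kerE colE mulmxA -colE => /eqP /matrixP /(_ i 0); rewrite !mxE.
have AUE : AU = row_mx Atil 0.
  rewrite -[LHS]hsubmxK; congr row_mx.
  by rewrite /AU /U mul_mx_row row_mxKr -mulmxA A0U2 mulmx0.
split=> // X.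
have sP : (mpinv R)^T = mpinv R by rewrite -mpinv_tr sR.
have sQ0 : Q0^T = Q0.
  rewrite /Q0; move: (mpinv R) sP => P sP.
  by rewrite linearB /= !trmx_mul trmxK sP sQ mulmxA.
have sQU : QU^T = QU by rewrite /QU !trmx_mul trmxK sQ0 mulmxA.
have toU : cgdare_solution A B Q S R X <->
    cgdare_solution (row_mx Atil 0) BU QU 0 R (U^T *m X *m U).
  apply: (iff_trans (cgdare_feedback A Q B S (mpinv R *m S^T) X sR)).
  apply: (iff_trans (cgdare_change_basis _ _ _ _ _ _ orthU)).
  (* With [F = R^+ S^T], [SRR] gives [F^T R = S]: the cross weight vanishes, and [F^T R F = S F]
     cancels one of the two subtracted terms, leaving [Q0]. *)
  rewrite trmx_mul trmxK sP SRR subrr mulmx0 [S *m (_ *m _)]mulmxA addrNK.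
  by rewrite [B *m (_ *m _)]mulmxA -/A0 -/Q0 -/AU -/BU -/QU AUE.
case: (orthU) => UtU UUt.
(* In the adapted coordinates the offset [Q0] becomes [QU], matching the shape [D + Q] of the block
   lemmas. *)
have XU D : X = U *m D *m U^T + Q0 <-> U^T *m X *m U = D + QU.
  split=> [->|e].
    by rewrite mulmxDr mulmxDl -/QU !mulmxA UtU mul1mx -mulmxA UtU mulmx1.
  have -> : D = U^T *m (X - Q0) *m U by rewrite mulmxBr mulmxBl e addrK.
  by rewrite !mulmxA UUt mul1mx -mulmxA UUt mulmx1 subrK.
split=> [/toU solU | [D [solD /XU eX]]]; last first.
  by apply/toU; rewrite eX; apply/cgdare_block_zero.
have [D eX] := cgdare_row_mx0 solU.
exists D; split; last exact/XU.
by apply/cgdare_block_zero => //; rewrite -eX.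
Qed.
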